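(* Let $A$ be a set and let $\Gamma$ be any set of unary relations on $A$ (i.e. subsets of $A$) containing some $\gamma\in\Gamma$ with $\emptyset\neq\gamma\subsetneq A$. Then the lattice $(\{\operatorname{Pol}_A Q\mid Q\subseteq \mathrm{DD}(\Gamma)\},\subseteq)$ contains a strictly descending $\omega$-chain of finitely related clones over $\mathrm{DD}(\Gamma)$; that is, there are finite sets $Q_1,Q_2,Q_3,\dots\subseteq \mathrm{DD}(\Gamma)$ such that $\operatorname{Pol}_A Q_{m+1}\subsetneq \operatorname{Pol}_A Q_m$ for all $m\geq 1$.
   Context: An $n$-ary relation on $A$ is a subset of $A^n$; an $n$-ary operation on $A$ is a map $A^n\to A$. Let $\mathrm{O}_A$ be the set of all operations on $A$ of arity $n\geq 1$. An $n$-ary operation $f$ preserves an $m$-ary relation $\rho\subseteq A^m$ (written $f\rhd\rho$) if for all $r_1,\dots,r_n\in\rho$ the $m$-tuple obtained by applying $f$ coordinatewise to $r_1,\dots,r_n$ is in $\rho$. For a set $Q$ of finitary relations on $A$ (of positive arity), $\operatorname{Pol}_A Q=\{f\in \mathrm{O}_A\mid f\rhd\rho \text{ for all }\rho\in Q\}$. A finitely related clone over $\mathrm{DD}(\Gamma)$ is one of the form $\operatorname{Pol}_A Q$ with $Q\subseteq\mathrm{DD}(\Gamma)$ finite. For $n\geq 1$ and $\gamma_1,\dots,\gamma_n\subseteq A$ put $\mathrm{R}(\gamma_1,\dots,\gamma_n)=\{(x_1,\dots,x_n)\in A^n\mid x_1\in\gamma_1\text{ or }\dots\text{ or }x_n\in\gamma_n\}$.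 For a set $\Gamma$ of unary relations on $A$, $\mathrm{DD}(\Gamma)$ is the set of all relations $\mathrm{R}(\gamma_1,\dots,\gamma_n)$ with $n\geq 1$ and $(\gamma_1,\dots,\gamma_n)\in\Gamma^n$. *)

(* Defs.v *)
From mathcomp Require Import all_boot.
From mathcomp Require Import boolp classical_sets cardinality.

Set Implicit Arguments.
Unset Strict Implicit.
Unset Printing Implicit Defensive.

Local Open Scope classical_set_scope.

(* n-tuples over A are functions 'I_n -> A.  Arities are positive: the tag n of
   an operation or a relation stands for the arity n.+1. *)
Definition operation (A : Type) : Type := {n : nat & ('I_n.+1 -> A) -> A}.

Definition relation (A : Type) : Type := {n : nat & set ('I_n.+1 -> A)}.

Definition preserves (A : Type) (f : operation A) (rho : relation A) : Prop :=
  forall r : 'I_(tag f).+1 -> 'I_(tag rho).+1 -> A,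
    (forall j, tagged rho (r j)) ->
    tagged rho (fun i => tagged f (fun j => r j i)).

Definition Pol (A : Type) (Q : set (relation A)) : set (operation A) :=
  [set f | forall rho, Q rho -> preserves f rho].

Definition Rdisj (A : Type) (n : nat) (gamma : 'I_n.+1 -> set A) : relation A :=
  existT _ n [set x : 'I_n.+1 -> A | exists i, gamma i (x i)].

Definition DD (A : Type) (Gamma : set (set A)) : set (relation A) :=
  [set rho | exists (n : nat) (gamma : 'I_n.+1 -> set A),
     (forall i, Gamma (gamma i)) /\ rho = Rdisj gamma].

(* Main.v *)
Require Import Defs.
From mathcomp Require Import all_boot.
From mathcomp Require Import boolp classical_sets cardinality.

(** For a fixed nontrivial [gamma], let [R_k] be the [k]-ary relation
    [R(gamma, ..., gamma)].  Repeating a coordinate shows that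
    [Pol R_(k+1)] is contained in [Pol R_k].  Fix [a0] outside and [a1] inside
    [gamma], and let the [k+1]-ary operation [f] return [a0] when at most one
    argument lies in [gamma], and [a1] otherwise.  If [f] maps [k] columns
    outside [gamma], these columns meet [gamma] in at most [k] of the [k+1]
    rows, i.e. some row is not in [R_k], so [f] preserves [R_k]; the [k+1] columns of the matrix with [a1] on
    the diagonal and [a0] elsewhere show that it does not preserve
    [R_(k+1)]. *)

Local Open Scope classical_set_scope.

(** The index is one less than the arity: this is [R_(m+1)]. *)
Definition Rconst {A : Type} (gamma : set A) (m : nat) : relation A :=
  @Rdisj A m (fun _ => gamma).

Lemma preserves_RconstS (A : Type) (gamma : set A) (m : nat) (f : operation A) :
  preserves f (Rconst gamma m.+1) -> preserves f (Rconst gamma m).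
Proof.
move=> pf r rP.
(* At the extra index [m.+1], [inord] defaults to [ord0], so coordinate 0 is repeated. *)
have [|i fi] := pf (fun j (i : 'I_m.+2) => r j (inord i : 'I_m.+1)).
  move=> j; have [i gi] := rP j.
  by exists (widen_ord (leqnSn _) i); rewrite /= inord_val.
by exists (inord i).
Qed.

Definition at_most_one {A : Type} (gamma : set A) {n : nat} (x : 'I_n -> A) :=
  forall j k, gamma (x j) -> gamma (x k) -> j = k.

Definition separating_op {A : Type} (gamma : set A) (a0 a1 : A) (n : nat) :
    operation A :=
  existT _ n (fun x => if `[< at_most_one gamma x >] then a0 else a1).

Lemma separating_op_preserves (A : Type) (gamma : set A) (a0 a1 : A) (m : nat) :
  gamma a1 ->
  preserves (separating_op gamma a0 a1 m.+1) (Rconst gamma m).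
Proof.
move=> ga1 r rP; have [c cP] := choice rP.
apply: contrapT => nex.
have col i : at_most_one gamma (r^~ i).
  apply: contrapT => ni; apply: nex; exists i => /=.
  by case: asboolP.
(* [c j] is a row where column [j] meets [gamma]; no row serves two columns, yet there are [m.+2]
   columns and [m.+1] rows. *)
have c_inj : injective c.
  move=> j k cjk; apply: (col (c j)) => /=; first exact: (cP j).
  by rewrite cjk; exact: (cP k).
by have := leq_card c c_inj; rewrite !card_ord ltnn.
Qed.

Lemma separating_op_not_preserves (A : Type) (gamma : set A) (a0 a1 : A)
    (m : nat) :
  ~ gamma a0 -> gamma a1 ->
  ~ preserves (separating_op gamma a0 a1 m.+1) (Rconst gamma m.+1).
Proof.
move=> ga0 ga1 /(_ (fun j i => if i == j then a1 else a0)) /= [|i].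
  by move=> j; exists j; rewrite eqxx.
(* Row [i] meets [gamma] only on the diagonal, so its value is [a0]. *)
case: asboolP => //; case=> j k.
by case: eqP => // <- _; case: eqP.
Qed.

Theorem proposition22 (A : Type) (Gamma : set (set A))
  (hGamma : exists gamma : set A,
     [/\ Gamma gamma, gamma !=set0 & gamma `<` [set: A]]) :
  exists Q : nat -> set (relation A),
    (forall m, finite_set (Q m) /\ Q m `<=` DD Gamma) /\
    (forall m, Pol (Q m.+1) `<` Pol (Q m)).
Proof.
have [gamma [Ggamma [a1 ga1] [_ /existsNP[a0 /not_implyP[_ ga0]]]]] := hGamma.
exists (fun m => [set Rconst gamma m]); split=> m.
  split; first exact: finite_set1.
  by move=> _ ->; exists m, (fun _ => gamma).
split=> [f pf _ ->|sub].
  by apply: preserves_RconstS; apply: pf.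
have /sub/(_ _ erefl) : Pol [set Rconst gamma m] (separating_op gamma a0 a1 m.+1).
  by move=> _ ->; apply: separating_op_preserves.
exact: separating_op_not_preserves.
Qed.
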